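(* Assume there exists $Q^\dagger\ge 0$ such that the deliverability constraint is non-binding for all $Q\ge Q^\dagger$, i.e. $D(1/\epsilon)=M\exp(-1)\le f(Q)$ for all $Q\ge Q^\dagger$ (so that the optimal price there is $p^*(Q)=e(Q)/\epsilon$). Suppose: (i) $C(Q)$ is strictly increasing for all $Q\ge Q^\dagger$ and $\lim_{Q\to\infty}C(Q)=+\infty$; (ii) $C(Q^\dagger)\le \dfrac{M\exp(-1)}{\epsilon}\,e(Q^\dagger)$. Then there exists a unique $Q^*\ge Q^\dagger$ such that $q^*(Q^* )=0$. Moreover, $Q^*$ is uniquely characterized (among $Q\ge Q^\dagger$) by the equation $$C(Q)=\frac{M\exp(-1)}{\epsilon}\,e(Q).$$
   Context: Constants: $M>0$, $\epsilon>0$, $k>0$. Real-valued functions of the renewable capacity $Q\ge 0$: emissions intensity $e(Q)>0$ with $e'(Q)<0$; delivered renewable electricity $f(Q)\ge 0$ with $f(0)=0$, $f'(Q)>0$, $f''(Q)<0$; marginal wholesale value $\pi(Q)$ with $\pi'(Q)<0$; costs $C_R(Q)\ge 0$, $C_S(Q)\ge 0$, assumed continuous. Demand is $D(x)=M\exp(-\epsilon x)$; revenue is $R(p,Q)=p\,D(p/e(Q))$; integrated non-investment cost is $C(Q)=C_S(Q)+C_R(Q)-f(Q)\pi(Q)$. The single-period problem at state $Q$ is to maximize $q$ over $(p,q)$ subject to the deliverability constraint $D(p/e(Q))\le f(Q)$, the financial constraint $C(Q)+kq\le R(p,Q)$, and $p,q\ge 0$. With $p^*(Q)$ the revenue-maximizing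 price under the deliverability constraint, the expansion is $$q^*(Q)=\frac{R(p^*(Q),Q)-C(Q)}{k}.$$ At states where deliverability is non-binding, $p^*(Q)=e(Q)/\epsilon$ and $R(p^*(Q),Q)=\frac{M\exp(-1)}{\epsilon}e(Q)$. *)

(* Defs.v *)
(* Stdlib reals, with Coquelicot for limits at infinity. *)
From Stdlib Require Import Reals ClassicalEpsilon.
From Coquelicot Require Import Coquelicot.
Open Scope R_scope.

(* Functions of the capacity live on [0, +oo).  They are represented by total
   functions R -> R of which only the values on this domain are constrained:
   derivatives and continuity are taken relative to it with Stdlib's [D_in] and
   [continue_in], and are therefore one-sided at 0. *)
Definition capacity (Q : R) : Prop := 0 <= Q.

Definition deriv_on (g dg : R -> R) : Prop :=
  forall Q, capacity Q -> D_in g dg capacity Q.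

Definition cont_on (g : R -> R) : Prop :=
  forall Q, capacity Q -> continue_in g capacity Q.

Definition demand (M eps x : R) : R := M * exp (- eps * x).

Definition revenue (M eps : R) (e : R -> R) (p Q : R) : R :=
  p * demand M eps (p / e Q).

Definition net_cost (CS CR f wv : R -> R) (Q : R) : R :=
  CS Q + CR Q - f Q * wv Q.

Definition deliverable (M eps : R) (e f : R -> R) (Q p : R) : Prop :=
  0 <= p /\ demand M eps (p / e Q) <= f Q.

Definition revenue_maximizing (M eps : R) (e f : R -> R) (Q p : R) : Prop :=
  deliverable M eps e f Q p /\
  forall p', deliverable M eps e f Q p' ->
    revenue M eps e p' Q <= revenue M eps e p Q.

(* Unspecified when no maximizer exists, e.g. at Q = 0, where f 0 = 0 < demand
   makes every price undeliverable. *)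
Definition pstar (M eps : R) (e f : R -> R) (Q : R) : R :=
  epsilon (inhabits 0) (revenue_maximizing M eps e f Q).

(* May be negative: the constraint 0 <= q is not built in. *)
Definition qstar (M eps k : R) (e f wv CR CS : R -> R) (Q : R) : R :=
  (revenue M eps e (pstar M eps e f Q) Q - net_cost CS CR f wv Q) / k.

(* Main.v *)
Require Import Defs.
From Stdlib Require Import Reals ClassicalEpsilon Lra.
From Coquelicot Require Import Coquelicot.
Open Scope R_scope.

(** The revenue [p * M * exp (- eps * p / e)] is maximal at [p = e / eps] because
    [x * exp (- x) <= exp (- 1)]; when that price is deliverable, the constrained
    maximal revenue is therefore [M * exp (-1) / eps * e].  Hence [k * qstar] is
    the difference of a strictly decreasing continuous function and the strictly
    increasing continuous net cost; it is nonnegative at [Qd] and tends to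
    [-oo], so it vanishes exactly once. *)

(* [g (Rmax 0 x)] extends the restriction of [g] to [0, +oo) continuously to
   the whole line, which makes the two-sided IVT and MVT applicable. *)
Lemma cont_on_extension (g : R -> R) :
  cont_on g -> continuity (fun x => g (Rmax 0 x)).
Proof.
intros Hg x eta Heta.
destruct (Hg (Rmax 0 x) (Rmax_l 0 x) eta Heta) as [alp [Halp Hlim]].
exists alp; split; [exact Halp|].
intros y [_ Hy]; simpl in *; unfold Rdist in *.
(* [continue_in] only speaks of points distinct from the base point, so points clamped to the same
   value are treated apart. Otherwise the bound transfers because [Rmax 0] is 1-Lipschitz. *)
destruct (Req_dec (Rmax 0 x) (Rmax 0 y)) as [E|E].
- rewrite E, Rminus_diag, Rabs_R0; exact Heta.
- apply Hlim; repeat split; [apply Rmax_l|exact E|].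
  apply Rle_lt_trans with (2 := Hy).
  unfold Rmax; destruct (Rle_dec 0 x), (Rle_dec 0 y);
    unfold Rabs; repeat destruct Rcase_abs; lra.
Qed.

Lemma deriv_on_cont_on (g dg : R -> R) : deriv_on g dg -> cont_on g.
Proof. intros Hg Q HQ; exact (cont_deriv g dg capacity Q (Hg Q HQ)). Qed.

Lemma cont_on_plus (g h : R -> R) :
  cont_on g -> cont_on h -> cont_on (fun x => g x + h x).
Proof. intros Hg Hh Q HQ; apply limit_plus; [apply Hg|apply Hh]; exact HQ. Qed.

Lemma cont_on_minus (g h : R -> R) :
  cont_on g -> cont_on h -> cont_on (fun x => g x - h x).
Proof. intros Hg Hh Q HQ; apply limit_minus; [apply Hg|apply Hh]; exact HQ. Qed.

Lemma cont_on_mult (g h : R -> R) :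
  cont_on g -> cont_on h -> cont_on (fun x => g x * h x).
Proof. intros Hg Hh Q HQ; apply limit_mul; [apply Hg|apply Hh]; exact HQ. Qed.

Lemma cont_on_const (c : R) : cont_on (fun _ => c).
Proof. intros Q HQ; exact (limit_free (fun _ => c) _ Q Q). Qed.

(** Near an interior point the clamp is the identity. At 0 the extension is constant on the left, so
    a two-sided derivative may fail to exist there. *)
Lemma deriv_on_is_derive (g dg : R -> R) (x : R) :
  deriv_on g dg -> 0 < x -> is_derive (fun y => g (Rmax 0 y)) x (dg x).
Proof.
intros Hg Hx; apply is_derive_Reals; intros eta Heta.
destruct (Hg x (Rlt_le _ _ Hx) eta Heta) as [alp [Halp Hlim]].
(* The radius is also capped by [x] so that [x + h] stays positive. *)
assert (Hm : 0 < Rmin alp x) by (apply Rmin_pos; lra).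
exists (mkposreal _ Hm); intros h Hh0 Hh; simpl in *; unfold Rdist in *.
assert (Hha := Rmin_l alp x); assert (Hhx := Rmin_r alp x).
assert (Hxh : 0 < x + h) by (revert Hh; unfold Rabs; destruct Rcase_abs; lra).
rewrite !Rmax_right by lra.
replace h with (x + h - x) at 2 by ring.
apply Hlim; repeat split; [unfold capacity; lra|lra|].
replace (x + h - x) with h by ring; lra.
Qed.

(** Mean value theorem for the extension. It asks for derivatives only inside the interval and for
    continuity at its ends, so [a = 0] is covered. *)
Lemma neg_deriv_on_decreasing (g dg : R -> R) (a b : R) :
  deriv_on g dg -> (forall Q, 0 <= Q -> dg Q < 0) ->
  0 <= a -> a < b -> g b < g a.
Proof.
intros Hg Hneg Ha Hab.
destruct (MVT_gen (fun x => g (Rmax 0 x)) a b dg) as [c [Hc Heq]].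
- rewrite Rmin_left, Rmax_right by lra; intros x Hx.
  apply deriv_on_is_derive; [exact Hg|lra].
- intros x _; apply cont_on_extension, (deriv_on_cont_on _ _ Hg).
- rewrite Rmin_left, Rmax_right in Hc by lra.
  rewrite !Rmax_right in Heq by lra.
  assert (Hd := Hneg c ltac:(lra)); nra.
Qed.

(** The tangent-line bound [x <= exp (x - 1)], multiplied by [exp (- x)]. *)
Lemma mul_exp_opp_le (x : R) : x * exp (- x) <= exp (- 1).
Proof.
replace (- 1) with ((x - 1) + - x) by ring; rewrite exp_plus.
apply Rmult_le_compat_r; [apply Rlt_le, exp_pos|].
generalize (exp_ineq1_le (x - 1)); lra.
Qed.

Lemma revenue_le (M eps : R) (e : R -> R) (p Q : R) :
  0 < M -> 0 < eps -> 0 < e Q ->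
  revenue M eps e p Q <= M * exp (-1) / eps * e Q.
Proof.
intros HM Heps He; unfold revenue, demand.
(* Rescaling the price to [x = eps * p / e Q] turns revenue into [M * e Q / eps] times
   [x * exp (- x)]. *)
replace (p * (M * exp (- eps * (p / e Q))))
  with (M * e Q / eps * (eps * p / e Q * exp (- (eps * p / e Q))))
  by (replace (- eps * (p / e Q)) with (- (eps * p / e Q)) by (field; lra);
      field; lra).
replace (M * exp (-1) / eps * e Q) with (M * e Q / eps * exp (-1))
  by (field; lra).
apply Rmult_le_compat_l; [|apply mul_exp_opp_le].
apply Rlt_le, Rdiv_lt_0_compat; nra.
Qed.

Lemma revenue_peak (M eps : R) (e : R -> R) (Q : R) :
  0 < eps -> 0 < e Q ->
  revenue M eps e (e Q / eps) Q = M * exp (-1) / eps * e Q.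
Proof.
intros Heps He; unfold revenue, demand.
replace (- eps * (e Q / eps / e Q)) with (-1) by (field; lra).
field; lra.
Qed.

(** The peak price is deliverable, so a maximizer exists and [epsilon] returns a genuine one.
    Whichever it returns, its revenue is squeezed between the peak value and the global bound. *)
Lemma revenue_pstar (M eps : R) (e f : R -> R) (Q : R) :
  0 < M -> 0 < eps -> 0 < e Q -> demand M eps (1 / eps) <= f Q ->
  revenue M eps e (pstar M eps e f Q) Q = M * exp (-1) / eps * e Q.
Proof.
intros HM Heps He Hf.
assert (Hdel : deliverable M eps e f Q (e Q / eps)).
{ split; [apply Rlt_le, Rdiv_lt_0_compat; assumption|].
  replace (e Q / eps / e Q) with (1 / eps) by (field; lra); exact Hf. }
assert (Hmax : revenue_maximizing M eps e f Q (pstar M eps e f Q)).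
{ apply (epsilon_spec (inhabits 0) (revenue_maximizing M eps e f Q)).
  exists (e Q / eps); split; [exact Hdel|].
  intros p' _; rewrite revenue_peak by assumption.
  apply revenue_le; assumption. }
apply Rle_antisym; [apply revenue_le; assumption|].
rewrite <- (revenue_peak M eps e Q) by assumption.
apply Hmax; exact Hdel.
Qed.

Lemma cont_on_root (g : R -> R) (a b : R) :
  cont_on g -> 0 <= a -> a < b -> 0 <= g a -> g b < 0 ->
  exists x, a <= x /\ g x = 0.
Proof.
intros Hg Ha Hab Hga Hgb.
destruct (IVT_cor (fun x => g (Rmax 0 x)) a b) as [x [Hx Hgx]].
- apply cont_on_extension; exact Hg.
- lra.
- rewrite !Rmax_right by lra; nra.
- rewrite Rmax_right in Hgx by lra.
  exists x; split; [lra|exact Hgx].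
Qed.

Theorem theorem2 :
  forall (M eps k : R)
         (e de f df ddf wv dwv CR CS : R -> R)
         (Qd : R),
  0 < M -> 0 < eps -> 0 < k ->
  (forall Q, 0 <= Q -> 0 < e Q) ->
  deriv_on e de ->
  (forall Q, 0 <= Q -> de Q < 0) ->
  (forall Q, 0 <= Q -> 0 <= f Q) ->
  f 0 = 0 ->
  deriv_on f df ->
  (forall Q, 0 <= Q -> 0 < df Q) ->
  deriv_on df ddf ->
  (forall Q, 0 <= Q -> ddf Q < 0) ->
  deriv_on wv dwv ->
  (forall Q, 0 <= Q -> dwv Q < 0) ->
  (forall Q, 0 <= Q -> 0 <= CR Q) ->
  cont_on CR ->
  (forall Q, 0 <= Q -> 0 <= CS Q) ->
  cont_on CS ->
  0 <= Qd ->
  (forall Q, Qd <= Q -> demand M eps (1 / eps) <= f Q) ->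
  (forall Q1 Q2, Qd <= Q1 -> Q1 < Q2 ->
     net_cost CS CR f wv Q1 < net_cost CS CR f wv Q2) ->
  is_lim (net_cost CS CR f wv) p_infty p_infty ->
  net_cost CS CR f wv Qd <= M * exp (-1) / eps * e Qd ->
  exists Qs : R,
    (Qd <= Qs /\ qstar M eps k e f wv CR CS Qs = 0) /\
    (forall Q, Qd <= Q -> qstar M eps k e f wv CR CS Q = 0 -> Q = Qs) /\
    (forall Q, Qd <= Q ->
       (net_cost CS CR f wv Q = M * exp (-1) / eps * e Q <-> Q = Qs)).
Proof.
intros M eps k e de f df ddf wv dwv CR CS Qd HM Heps Hk He Hde Hdeneg _ _
  Hdf _ _ _ Hdwv _ _ HCR _ HCS HQd Hdel Hinc Hlim Hini.
set (C := net_cost CS CR f wv) in *.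
set (m := M * exp (-1) / eps) in *.
assert (Hm : 0 < m)
  by (apply Rdiv_lt_0_compat; [apply Rmult_lt_0_compat, exp_pos|]; assumption).
(* Reduces every claim about [qstar] to the balance equation between cost and peak revenue. *)
assert (Hq : forall Q, Qd <= Q ->
  (qstar M eps k e f wv CR CS Q = 0 <-> C Q = m * e Q)).
{ intros Q HQ; unfold qstar; fold C.
  rewrite revenue_pstar; [|assumption|assumption|apply He; lra|auto].
  fold m; split; intros H.
  - apply (f_equal (Rmult k)) in H; field_simplify in H; lra.
  - rewrite H; field; lra. }
assert (Hedec : forall Q1 Q2, Qd <= Q1 -> Q1 < Q2 -> e Q2 < e Q1)
  by (intros; apply (neg_deriv_on_decreasing e de); auto; lra).
assert (Huniq : forall Q1 Q2, Qd <= Q1 -> Qd <= Q2 ->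
  C Q1 = m * e Q1 -> C Q2 = m * e Q2 -> Q1 = Q2).
{ intros Q1 Q2 H1 H2 E1 E2.
  destruct (Rtotal_order Q1 Q2) as [H|[H|H]]; [exfalso|exact H|exfalso].
  - assert (I := Hinc Q1 Q2 H1 H); assert (J := Hedec Q1 Q2 H1 H); nra.
  - assert (I := Hinc Q2 Q1 H2 H); assert (J := Hedec Q2 Q1 H2 H); nra. }
apply is_lim_spec in Hlim; destruct (Hlim (m * e Qd)) as [B HB].
(* The [+ 1] puts [b] strictly beyond both [Qd] and [B]. There [C b > m * e Qd > m * e b], which is
   the negative sign needed at the right end. *)
set (b := Rmax Qd B + 1).
assert (Hb : Qd < b /\ B < b)
  by (unfold b; generalize (Rmax_l Qd B) (Rmax_r Qd B); lra).
assert (HCb := HB b (proj2 Hb)).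
assert (Heb := Hedec Qd b (Rle_refl _) (proj1 Hb)).
destruct (cont_on_root (fun Q => m * e Q - C Q) Qd b) as [Qs [HQs Hroot]].
- apply cont_on_minus.
  + apply cont_on_mult; [apply cont_on_const|exact (deriv_on_cont_on _ _ Hde)].
  + apply cont_on_minus; [apply cont_on_plus; assumption|].
    apply cont_on_mult; eapply deriv_on_cont_on; eassumption.
- exact HQd.
- apply Hb.
- lra.
- nra.
- assert (HC : C Qs = m * e Qs) by lra.
  exists Qs; split; [split; [exact HQs|apply Hq; assumption]|split].
  + intros Q HQ H; apply Huniq; auto; apply Hq; assumption.
  + intros Q HQ; split; [intros H; apply Huniq; auto|intros ->; exact HC].
Qed.
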